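(* Let $\mathbb{K}$ be a field of characteristic zero, let $P(t)\in\mathbb{K}[t]$ have degree $n\ge 1$, and let $Q_1(t),\dots,Q_r(t)\in\mathbb{K}[t]$ be polynomials of degree at most $n$, not all of which are scalar multiples of $P$. Let $\Phi=\{\phi_0,\dots,\phi_{n-1}\}$ be a basis of the space of polynomials of degree at most $n-1$. Let $n-k$ be the rank of the matrix $\mathbf{B}^P_\Phi(Q_1,\ldots,Q_r)$, and let $t_1,\ldots,t_n$ be the columns of the matrix $$\mathbf{T}=\mathbf{B}^P_\Phi(Q_1,\ldots,Q_r)\,\mathbf{P}_{\Phi\rightarrow\mathrm{St}}^{T}.$$ If $h_{k-i}^{j}\in\mathbb{K}$ are such that $$t_{k-i}=\sum_{j=k+1}^{n}h_{k-i}^{j}\,t_{j},\qquad i=0,\ldots,k-1,$$ and $$\begin{pmatrix} d_0\\ d_1\\ d_2\\ \vdots\\ d_k\end{pmatrix}=d_0\begin{pmatrix}1\\ h_k^{k+1}\\ h_{k-1}^{k+1}\\ \vdots\\ h_1^{k+1}\end{pmatrix}$$ with $d_0\in\mathbb{K}$, $d_0\neq 0$, then $$D=d_0t^k+d_1t^{k-1}+\cdots+d_{k-1}t+d_k$$ is a greatest common divisor of the polynomials $P(t),Q_1(t),\ldots,Q_r(t)$.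
   Context: Bezout matrix: for polynomials $P,Q\in\mathbb{K}[t]$ with $n=\max\{\deg P,\deg Q\}$, the Cayley quotient is $C_{P,Q}(t,x)=\frac{P(t)Q(x)-P(x)Q(t)}{t-x}$, a bivariate polynomial of degree at most $n-1$ in each variable. Given a basis $\Phi=\{\phi_0,\dots,\phi_{n-1}\}$ of the space of polynomials of degree at most $n-1$, write uniquely $C_{P,Q}(t,x)=\sum_{i,j=0}^{n-1} b_{ij}\,\phi_i(t)\phi_j(x)$; the symmetric $n\times n$ matrix $\mathrm{Bez}_\Phi(P,Q)=(b_{ij})$ is the Bezout matrix of $P,Q$ in the basis $\Phi$. $\mathbf{B}^P_\Phi(Q_1,\ldots,Q_r)$ is the $rn\times n$ matrix obtained by stacking $\mathrm{Bez}_\Phi(P,Q_1),\dots,\mathrm{Bez}_\Phi(P,Q_r)$ vertically, in this order. $\mathrm{St}=\{1,t,\dots,t^{n-1}\}$ is the monomial basis. The transformation matrix $\mathbf{P}_{\Phi\to\mathrm{St}}$ is the invertible $n\times n$ matrix over $\mathbb{K}$ defined by $(1,t,\ldots,t^{n-1})\,\mathbf{P}_{\Phi\to\mathrm{St}}=(\phi_0(t),\ldots,\phi_{n-1}(t))$. The superscript $T$ denotes transpose. *)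

(* Defs.v *)
From HB Require Import structures.
From mathcomp Require Import all_boot all_order all_algebra.

Set Implicit Arguments.
Unset Strict Implicit.
Unset Printing Implicit Defensive.

Import GRing.Theory.
Local Open Scope ring_scope.

(* Bivariate polynomials in (t, x) are elements of {poly {poly K}} with t the
   outer variable 'X and x the inner variable 'Y (notations of polyXY), so
   that F(t) is F^:P and F(x) is F%:P. *)

Section Bezout.

Variable K : fieldType.

Definition cayley_num (P Q : {poly K}) : {poly {poly K}} :=
  P^:P * Q%:P - P%:P * Q^:P.

(* The divisor is monic in 'X, hence %/ is true Euclidean division in
   K[x][t]; it is exact by cayleyP. *)
Definition cayley (P Q : {poly K}) : {poly {poly K}} :=
  cayley_num P Q %/ ('X - 'Y).

Lemma cayleyP P Q : cayley P Q * ('X - 'Y) = cayley_num P Q.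
Proof.
rewrite /cayley; apply/esym/eqP.
rewrite -(Pdiv.IdomainMonic.dvdp_eq (monicXsubC _)).
have hd (F : {poly K}) : ('X - 'Y : {poly {poly K}}) %| F^:P - F%:P.
  rewrite -root_factor_theorem; apply/rootP; rewrite hornerD hornerN hornerC.
  by rewrite [_.['X]](comp_polyXr F) subrr.
have -> : cayley_num P Q = (P^:P - P%:P) * Q%:P - P%:P * (Q^:P - Q%:P).
  by rewrite /cayley_num mulrBl mulrBr opprB addrA subrK.
by apply: dvdp_sub; [exact: dvdp_mulr | exact: dvdp_mull].
Qed.

Lemma cayley_sym P Q : swapXY (cayley P Q) = cayley P Q.
Proof.
have nz : ('X - 'Y : {poly {poly K}}) != 0 by rewrite polyXsubC_eq0.
apply: (mulIf nz); rewrite cayleyP.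
have -> : ('X - 'Y : {poly {poly K}}) = - swapXY ('X - 'Y).
  by rewrite rmorphB /= swapXY_X swapXY_Y opprB.
rewrite mulrN -rmorphM /= cayleyP rmorphB !rmorphM /= !swapXY_map_polyC.
by rewrite !swapXY_polyC opprB.
Qed.

Lemma size_cayley n (P Q : {poly K}) :
  (size P <= n.+1)%N -> (size Q <= n.+1)%N -> (size (cayley P Q) <= n)%N.
Proof.
move=> sP sQ; have [->|nz] := eqVneq (cayley P Q) 0; first by rewrite size_poly0.
have : (size (cayley_num P Q) <= n.+1)%N.
  rewrite /cayley_num (leq_trans (size_polyD _ _)) // geq_max size_polyN.
  rewrite [_ * Q%:P]mulrC !mul_polyC !(leq_trans (size_scale_leq _ _)) //.
    by rewrite size_map_polyC.
  by rewrite size_map_polyC.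
by rewrite -cayleyP size_Mmonic ?monicXsubC // size_XsubC addn2.
Qed.

Section Basis.

Variable n : nat.
Implicit Type Phi : n.-tuple {poly_n K}.

(* b_ij is the coordinate of C_{P,Q} on phi_i(t) phi_j(x), obtained by
   expanding each monomial t^a x^b of C_{P,Q}, whose coefficient is
   (cayley P Q)`_a`_b. See bezmxP for the characteristic property. *)
Definition bezmx Phi (P Q : {poly K}) : 'M[K]_n :=
  \matrix_(i, j) \sum_(a < n) \sum_(b < n)
    (cayley P Q)`_a`_b * coord Phi i (npolyp n 'X^a) * coord Phi j (npolyp n 'X^b).

Definition stacked_bezmx Phi (P : {poly K}) r (Q : 'I_r -> {poly K}) :
    'M[K]_(\sum_(l < r) n, n) :=
  \mxcol_(l < r) bezmx Phi P (Q l).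

Definition basis_to_St Phi : 'M[K]_n := \matrix_(i, j) (tnth Phi j)`_i.

Lemma basis_to_StP Phi (M : 'M[K]_n) :
  (\row_(i < n) 'X^i *m map_mx polyC M = \row_(j < n) (tnth Phi j : {poly K}))
  <-> M = basis_to_St Phi.
Proof.
have rowE (A : 'M[K]_n) (j : 'I_n) :
    (\row_(i < n) 'X^i *m map_mx polyC A) 0 j = \sum_(i < n) A i j *: 'X^i.
  by rewrite mxE; apply: eq_bigr => i _; rewrite !mxE mulrC mul_polyC.
split=> [eqM | ->].
  apply/matrixP=> i j; rewrite mxE; move/rowP/(_ j): eqM; rewrite rowE mxE => <-.
  rewrite coef_sum (bigD1 i) //= coefZ coefXn eqxx mulr1 big1 ?addr0 // => k neq.
  by rewrite coefZ coefXn eq_sym (negPf (neq : k != i :> nat)) mulr0.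
apply/rowP=> j; rewrite rowE mxE [RHS](npolyX_gen (size_npoly _)).
rewrite raddf_sum; apply: eq_bigr => i _.
by rewrite mxE -npolyXE.
Qed.

Lemma coord_coef Phi (i : 'I_n) (p : {poly_n K}) :
  \sum_(a < n) p`_a * coord Phi i (npolyp n 'X^a) = coord Phi i p.
Proof.
rewrite [in RHS](coord_basis (npolyX_full K n) (memvf p)) linear_sum /=.
by apply: eq_bigr => a _; rewrite linearZ /= npolyX_coords nth_npolyX
  tnth_map tnth_ord_tuple.
Qed.

Lemma coord_Phi Phi (i k : 'I_n) : basis_of fullv Phi ->
  coord Phi i (tnth Phi k) = (k == i)%:R.
Proof.
by move=> /basis_free fPhi; rewrite (tnth_nth 0) coord_free // eq_sym.
Qed.

Lemma basis_to_St_unit Phi :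
  basis_of fullv Phi -> basis_to_St Phi \in unitmx.
Proof.
move=> bPhi; pose N : 'M[K]_n := \matrix_(i, a) coord Phi i (npolyp n 'X^a).
have /mulmx1_unit[] // : N *m basis_to_St Phi = 1%:M.
apply/matrixP=> i k; rewrite !mxE eq_sym -(coord_Phi i k bPhi) -coord_coef.
by apply: eq_bigr => a _; rewrite !mxE mulrC.
Qed.

Lemma bezmxP Phi (P Q : {poly K}) (B : 'M[K]_n) :
  basis_of fullv Phi -> (size P <= n.+1)%N -> (size Q <= n.+1)%N ->
  (cayley P Q = \sum_(i < n) \sum_(j < n)
     (B i j)%:P%:P * (tnth Phi i : {poly K})^:P * (tnth Phi j : {poly K})%:P)
  <-> B = bezmx Phi P Q.
Proof.
move=> bPhi sP sQ.
pose S (B : 'M[K]_n) := \sum_(i < n) \sum_(j < n)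
     (B i j)%:P%:P * (tnth Phi i : {poly K})^:P * (tnth Phi j : {poly K})%:P.
have coefS (A : 'M[K]_n) (a b : nat) : (S A)`_a`_b =
    \sum_i \sum_j A i j * (tnth Phi i)`_a * (tnth Phi j)`_b.
  rewrite !coef_sum; apply: eq_bigr => i _; rewrite !coef_sum.
  apply: eq_bigr => j _.
  by rewrite coefMC coefCM coef_map /= -polyCM coefCM.
have Phi_expand a c : (c < n)%N -> (a < n)%N ->
    \sum_(i < n) coord Phi i (npolyp n 'X^a) * (tnth Phi i)`_c = (c == a)%:R.
  move=> cn an; transitivity ((npolyp n 'X^a : {poly_n K})`_c).
    rewrite [X in _ = (polyn X)`_c](coord_basis bPhi (memvf _)) coefn_sum.
    by apply: eq_bigr => i _; rewrite coefZ -tnth_nth.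
  by rewrite coef_npolyp cn coefXn.
have deltaE (F : nat -> K) c : (c < n)%N ->
    \sum_(a < n) F a * (c == a)%:R = F c.
  move=> cn; rewrite (bigD1 (Ordinal cn)) //= eqxx mulr1 big1 ?addr0 //.
  move=> a; rewrite -val_eqE /= => neq.
  by rewrite eq_sym (negPf neq) mulr0.
have sumM (F G : 'I_n -> K) : 
    \sum_i \sum_j F i * G j = (\sum_i F i) * (\sum_j G j).
  by rewrite mulr_suml; apply: eq_bigr => i _; rewrite mulr_sumr.
rewrite -/(S B); split=> [eqC | ->].
  apply/matrixP=> i j; rewrite mxE eqC.
  transitivity (\sum_k \sum_l B k l * ((k == i)%:R * (l == j)%:R)).
    rewrite (bigD1 i) //= (bigD1 j) //= !eqxx !mulr1 !big1 ?addr0 //.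
      by move=> k /negPf ->; rewrite big1 // => l _; rewrite mul0r mulr0.
    by move=> l /negPf ->; rewrite mulr0 mulr0.
  under [RHS]eq_bigr => a _ do under eq_bigr => b _ do
    rewrite coefS !mulr_suml.
  under [RHS]eq_bigr => a _ do rewrite exchange_big /=.
  rewrite [RHS]exchange_big /=; apply: eq_bigr => k _.
  under [RHS]eq_bigr => a _ do under eq_bigr => b _ do rewrite !mulr_suml.
  under [RHS]eq_bigr => a _ do rewrite exchange_big /=.
  rewrite [RHS]exchange_big /=; apply: eq_bigr => l _.
  rewrite -(coord_Phi i k bPhi) -(coord_Phi j l bPhi) -!coord_coef -sumM.
  rewrite mulr_sumr; apply: eq_bigr => a _.
  rewrite mulr_sumr; apply: eq_bigr => b _.
  by rewrite -!mulrA; congr (_ * _); rewrite [LHS]mulrCA mulrCA;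
     congr (_ * _); rewrite mulrCA.
apply/polyP=> c; apply/polyP=> d; rewrite coefS.
have sC := size_cayley sP sQ.
have [cn|nc] := ltnP c n; last first.
  rewrite [(cayley P Q)`_c]nth_default ?(leq_trans sC) // coef0.
  rewrite big1 // => i _; rewrite big1 // => j _.
  by rewrite (big_coef_npoly _ nc) mulr0 mul0r.
have [dn|nd] := ltnP d n; last first.
  rewrite -{1}cayley_sym coef_swapXY [(cayley P Q)`_d]nth_default ?(leq_trans sC) //.
  rewrite coef0 big1 // => i _; rewrite big1 // => j _.
  by rewrite (big_coef_npoly _ nd) mulr0.
under eq_bigr => i _ do under eq_bigr => j _ do rewrite mxE !mulr_suml.
under eq_bigr => i _ do rewrite exchange_big /=.
rewrite exchange_big /=.
rewrite -[LHS](@deltaE (fun a => (cayley P Q)`_a`_d) c cn); apply: eq_bigr => a _.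
under eq_bigr => i _ do under eq_bigr => j _ do rewrite !mulr_suml.
under eq_bigr => i _ do rewrite exchange_big /=.
rewrite exchange_big /=.
rewrite -[X in X * _](@deltaE (fun b => (cayley P Q)`_a`_b) d dn) mulr_suml.
apply: eq_bigr => b _.
rewrite -(Phi_expand a c cn (ltn_ord a)) -(Phi_expand b d dn (ltn_ord b)).
rewrite -mulrA [X in _ * X]mulrC -sumM mulr_sumr; apply: eq_bigr => i _.
rewrite mulr_sumr; apply: eq_bigr => j _.
by rewrite -!mulrA; congr (_ * _); congr (_ * _); rewrite mulrCA.
Qed.

End Basis.

Definition is_gcd r (P : {poly K}) (Q : 'I_r -> {poly K}) (D : {poly K}) :=
  [/\ D %| P, forall l, D %| Q l &
      forall E : {poly K}, E %| P -> (forall l, E %| Q l) -> E %| D].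

End Bezout.

(* Main.v *)
Require Import Defs.
From mathcomp Require Import all_boot all_order all_algebra.

(** Let C_a(x) be the coefficient of t^a in the Cayley quotient C(t, x) of P
and Q. Comparing coefficients in (t - x) C(t, x) = P(t) Q(x) - P(x) Q(t) gives

  x C_a = C_(a-1) + Q_a P - P_a Q        (with C_(-1) = C_n = 0),

and this recurrence (cayley_coef0, cayley_coefS) carries the whole proof.

- Read downwards from C_n = 0, it shows that a common divisor of P and Q
  divides every C_a (dvdp_cayley_coef).
- Read modulo P, it shows that the span of the C_a is stable under
  multiplication by x; as C_(n-1) = P_n Q - Q_n P, this span contains f Q mod P
  for every f (poly_rV_modp_sub_cayley_mx).

Changing basis turns the blocks of T into invertible multiples of the matrices
with rows C_a (bezmx_mul_basis_to_St). Hence the rows of T, read as polynomials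
of degree less than n, are multiples of the gcd G of P and the Q_l, so that
rank T <= n - deg G, that is deg G <= k. Conversely G itself is in the row
space of T, provided that deg G < n (poly_rV_gcd_sub); the case deg G = n is
excluded, for then P divides every Q_l, which makes every Q_l a scalar multiple
of P.

A linear relation between the columns of T holds between the entries of every
vector of its row space, hence between the coefficients of G. The given
relations thus express the coefficients of G in degrees below k by those in
degrees at least k. If deg G were less than k, the latter would vanish and so
would G. Therefore deg G = k, the only surviving term on the right is the
leading coefficient of G, and the coefficient of t^m in G is h_(m+1)^(k+1) times
it: D and G are proportional. *)

Import GRing.Theory.
Local Open Scope ring_scope.

Section CayleyCoefficients.

Context {K : fieldType}.
Implicit Types P Q G f : {poly K}.

Lemma cayley_coefC P Q a b : (cayley P Q)`_a`_b = (cayley P Q)`_b`_a.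
Proof. by rewrite -{1}cayley_sym coef_swapXY. Qed.

Lemma size_cayley_coef {n P Q} a :
  (size P <= n.+1)%N -> (size Q <= n.+1)%N -> (size ((cayley P Q)`_a)%R <= n)%N.
Proof.
move=> sP sQ; apply/leq_sizeP => b le_nb.
rewrite cayley_coefC [(cayley P Q)`_b]nth_default ?coef0 //.
exact: leq_trans (size_cayley sP sQ) le_nb.
Qed.

Lemma coef_cayley_num P Q a :
  (cayley_num P Q)`_a = P`_a *: Q - Q`_a *: P.
Proof.
by rewrite coefB coefMC coefCM !coef_map /= mul_polyC [P * _]mulrC mul_polyC.
Qed.

Lemma cayley_coef0 P Q : 'X * (cayley P Q)`_0 = Q`_0 *: P - P`_0 *: Q.
Proof.
rewrite -[RHS]opprB -coef_cayley_num -cayleyP mulrBr coefB coefMX coefMC /=.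
by rewrite sub0r opprK mulrC.
Qed.

Lemma cayley_coefS P Q a :
  'X * (cayley P Q)`_a.+1 = (cayley P Q)`_a + Q`_a.+1 *: P - P`_a.+1 *: Q.
Proof.
rewrite -addrA -[X in _ + X]opprB -coef_cayley_num -cayleyP mulrBr coefB.
by rewrite coefMX coefMC /= opprB addrC subrK mulrC.
Qed.

Lemma cayley_coef_top n P Q : (size P <= n.+1)%N -> (size Q <= n.+1)%N ->
  (cayley P Q)`_n = 0.
Proof. by move=> sP sQ; rewrite nth_default // size_cayley. Qed.

(** Downward induction on a, from the zero coefficient of index n: the
recurrence expresses C_(a-1) by C_a, P and Q. *)
Lemma dvdp_cayley_coef n P Q G a : (size P <= n.+1)%N -> (size Q <= n.+1)%N ->
  G %| P -> G %| Q -> G %| (cayley P Q)`_a.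
Proof.
move=> sP sQ GP GQ; have [le_na|/ltnW le_an] := leqP n a.
  by rewrite nth_default ?dvdp0 // (leq_trans (size_cayley sP sQ)).
rewrite -(subKn le_an); elim: (n - a)%N (leq_subr a n) => [|e IHe] lt_en.
  by rewrite subn0 cayley_coef_top // dvdp0.
have -> : (cayley P Q)`_(n - e.+1) =
    'X * (cayley P Q)`_(n - e) + P`_(n - e) *: Q - Q`_(n - e) *: P.
  by rewrite -(subnSK lt_en) cayley_coefS subrK addrK.
rewrite -!mul_polyC dvdp_sub ?dvdp_add ?dvdp_mull //.
by rewrite IHe // ltnW.
Qed.

Definition cayley_mx n P Q : 'M[K]_n := \matrix_(a < n) poly_rV (cayley P Q)`_a.

(** Modulo P, the span of the C_a is stable under multiplication by x and
contains Q, so it contains the image of the ideal generated by Q. *)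
Lemma poly_rV_modp_sub_cayley_mx n P Q f :
  size P = n.+1 -> (size Q <= n.+1)%N ->
  (poly_rV ((f * Q) %% P) <= cayley_mx n P Q)%MS.
Proof.
case: n => [|m] sP sQ; first by rewrite [poly_rV _]thinmx0 sub0mx.
have sP' : (size P <= m.+2)%N by rewrite sP.
have lcP : P`_m.+1 != 0.
  rewrite (_ : P`_m.+1 = lead_coef P); last by rewrite lead_coefE sP.
  by rewrite lead_coef_eq0 -size_poly_eq0 sP.
pose inS p := (poly_rV (p %% P) <= cayley_mx m.+1 P Q)%MS.
have inSD p q : inS p -> inS q -> inS (p + q).
  by rewrite /inS modpD linearD; apply: addmx_sub.
have inSZ c p : inS p -> inS (c *: p).
  by rewrite /inS modpZl linearZ; apply: scalemx_sub.
have inSN p : inS p -> inS (- p) by rewrite -scaleN1r; apply/inSZ.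
have inSP c p : inS (p * (c *: P)).
  by rewrite /inS -scalerAr modpZl modp_mull scaler0 linear0 sub0mx.
have inSC a : inS (cayley P Q)`_a.
  rewrite /inS modp_small ?sP ?ltnS ?(size_cayley_coef _ sP') //.
  have [lt_am|le_ma] := ltnP a m.+1.
    by rewrite -(rowK (fun a : 'I__ => _ (cayley P Q)`_a) (Ordinal lt_am)) row_sub.
  by rewrite nth_default ?linear0 ?sub0mx // (leq_trans (size_cayley sP' sQ)).
(* The recurrence at the vanishing coefficient C_(m+1) reads
   C_m = P_(m+1) Q - Q_(m+1) P, so C_m is a nonzero multiple of Q modulo P. *)
have inSQ p : inS (p * (cayley P Q)`_m) -> inS (p * Q).
  have : (cayley P Q)`_m = P`_m.+1 *: Q - Q`_m.+1 *: P.
    apply/eqP; rewrite -subr_eq0 opprB addrA -cayley_coefS.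
    by rewrite cayley_coef_top // mulr0.
  move/eqP; rewrite eq_sym subr_eq => /eqP eqQ inSp.
  rewrite -[Q](scalerK lcP) eqQ -scalerAr mulrDr.
  by apply/inSZ; apply/inSD.
suff inSfC a : inS (f * (cayley P Q)`_a) by apply/inSQ; apply: inSfC.
elim/poly_ind: f a => [|f c IHf] a; first by rewrite mul0r -(mul0r (0 *: P)).
rewrite mulrDl mul_polyC; apply/inSD; last exact: inSZ.
rewrite -mulrA; case: a => [|a].
  rewrite cayley_coef0 mulrBr; apply/inSD => //; apply/inSN.
  by rewrite -scalerAr; apply/inSZ; apply/inSQ.
rewrite cayley_coefS mulrBr mulrDr; apply/inSD.
  exact: inSD.
by apply/inSN; rewrite -scalerAr; apply/inSZ; apply/inSQ.
Qed.

(** When G has degree g, the rows x^i G (i < n - g) span the multiples of G of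
degree less than n. There are n - g of them, which bounds the rank of any
matrix with rows among these multiples. *)
Definition multiples_mx n g G : 'M[K]_(n - g, n) :=
  \matrix_(i < n - g) poly_rV ('X^i * G).

Lemma poly_rV_sub_multiples_mx n g G f :
  size G = g.+1 -> (size f <= n)%N -> G %| f ->
  (poly_rV f <= multiples_mx n g G)%MS.
Proof.
move=> sG sf Gf; have G0 : G != 0 by rewrite -size_poly_eq0 sG.
have sfG : (size (f %/ G)%R <= n - g)%N by rewrite size_divp // sG leq_sub2r.
rewrite -(divpK Gf) -(poly_rV_K sfG) /rVpoly poly_def mulr_suml linear_sum.
apply: summx_sub => j _; rewrite -scalerAl linearZ scalemx_sub //=.
by rewrite (submx_trans _ (row_sub j (multiples_mx n g G))) // rowK.
Qed.

Lemma cayley_mx_sub_multiples n g P Q G :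
  (size P <= n.+1)%N -> (size Q <= n.+1)%N -> size G = g.+1 ->
  G %| P -> G %| Q -> (cayley_mx n P Q <= multiples_mx n g G)%MS.
Proof.
move=> sP sQ sG GP GQ; apply/row_subP => a; rewrite rowK.
apply: poly_rV_sub_multiples_mx; rewrite ?size_cayley_coef //.
exact: (dvdp_cayley_coef n).
Qed.

End CayleyCoefficients.

Section Stacking.

Context {K : fieldType}.

(** With N the transformation matrix, the Bezout matrix in the basis Phi is
N^-1 C N^-T, where C is the Bezout matrix in the monomial basis; multiplying by
N^T on the right leaves N^-1 C, which has the row space of C. *)
Lemma bezmx_mul_basis_to_St n (Phi : n.-tuple {poly_n K}) (P Q : {poly K}) :
  basis_of fullv Phi ->
  bezmx Phi P Q *m (basis_to_St Phi)^T =
    invmx (basis_to_St Phi) *m cayley_mx n P Q.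
Proof.
move=> bPhi; set N := basis_to_St Phi; have uN := basis_to_St_unit bPhi.
pose c : 'M[K]_n := \matrix_(i, a) coord Phi i (npolyp n 'X^a).
have cN : c *m N = 1%:M.
  apply/matrixP => i k; rewrite !mxE eq_sym -(coord_Phi i k bPhi) -coord_coef.
  by apply: eq_bigr => a _; rewrite !mxE mulrC.
have <- : c = invmx N by rewrite -[c](mulmxK uN) cN mul1mx.
have -> : bezmx Phi P Q = c *m cayley_mx n P Q *m c^T.
  apply/matrixP => i j; rewrite !mxE exchange_big; apply: eq_bigr => b _ /=.
  rewrite !mxE mulr_suml; apply: eq_bigr => a _; rewrite !mxE.
  by rewrite [_`_b * _]mulrC.
by rewrite -mulmxA -trmx_mul (mulmx1C cN) trmx1 mulmx1.
Qed.

Lemma submxcol_sub r n (p_ : 'I_r -> nat) (A : 'M[K]_(\sum_(l < r) p_ l, n)) l :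
  (submxcol A l <= A)%MS.
Proof.
apply/row_subP => i; apply: submx_trans (row_sub (tagnat.Rank l i) A).
rewrite (_ : row i _ = row (tagnat.Rank l i) A) //.
by apply/rowP => j; rewrite !mxE.
Qed.

(** A vector of the row space is a combination u *m A of the rows, and u *m _
transports linear relations between the columns of A to its entries. *)
Lemma row_space_col_relation m n (A : 'M[K]_(m, n)) (v : 'rV_n) j0
    (S : pred 'I_n) (c : 'I_n -> K) :
  (v <= A)%MS -> col j0 A = \sum_(j | S j) c j *: col j A ->
  v 0 j0 = \sum_(j | S j) c j * v 0 j.
Proof.
case/submxP=> u -> colA.
have uAE j : (u *m A) 0 j = (u *m col j A) 0 0.
  by rewrite !mxE; apply: eq_bigr => s _; rewrite mxE.
rewrite uAE colA mulmx_sumr summxE.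
by apply: eq_bigr => j _; rewrite uAE -scalemxAr mxE.
Qed.

End Stacking.

Section Gcd.

Context {K : fieldType} {r : nat} (P : {poly K}) (Q : 'I_r -> {poly K}).

Lemma is_gcd_big : is_gcd P Q (\big[@gcdp K/P]_(l < r) Q l).
Proof.
have dvdE s E : (E %| \big[@gcdp K/P]_(l <- s) Q l) =
    (E %| P) && all (fun l => E %| Q l) s.
  elim: s => [|l s IHs]; first by rewrite big_nil andbT.
  by rewrite big_cons dvdp_gcd IHs /= andbCA.
move: (dvdE (index_enum 'I_r) (\big[@gcdp K/P]_(l < r) Q l)).
rewrite dvdpp => /esym/andP[GP /allP GQ].
split=> // [l|E EP EQ]; first by apply: GQ; rewrite mem_index_enum.
by rewrite dvdE EP; apply/allP => l _.
Qed.

Lemma is_gcd_eqp D G : D %= G -> is_gcd P Q G -> is_gcd P Q D.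
Proof.
move=> eqDG [GP GQ maxG]; split=> [|l|E EP EQ]; rewrite ?(eqp_dvdl _ eqDG) //.
by rewrite (eqp_dvdr _ eqDG) maxG.
Qed.

(** Bezout's identity: the gcd belongs to every ideal containing P and the
Q l. *)
Lemma gcd_ideal (I : {poly K} -> Prop) :
  (forall p q, I p -> I q -> I (p + q)) -> (forall u p, I p -> I (u * p)) ->
  I P -> (forall l, I (Q l)) -> I (\big[@gcdp K/P]_(l < r) Q l).
Proof.
move=> ID IM IP IQ; apply: big_ind => // p q Ip Iq.
have [u] := Bezoutp p q; rewrite eqp_sym => /eqpf_eq[c _ ->].
by rewrite -mul_polyC; apply/IM; apply/ID; apply/IM.
Qed.

(** The polynomials all of whose multiples reduce, modulo P, into the row space
of A form an ideal containing P and the Q l, hence also their gcd. *)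
Lemma poly_rV_gcd_sub n m (A : 'M[K]_(m, n)) :
  size P = n.+1 -> (forall l, (size (Q l) <= n.+1)%N) ->
  (forall l, (cayley_mx n P (Q l) <= A)%MS) ->
  (size (\big[@gcdp K/P]_(l < r) Q l)%R <= n)%N ->
  (poly_rV (\big[@gcdp K/P]_(l < r) Q l) <= A)%MS.
Proof.
move=> sP sQ QA; set G := \big[_/_]_(l < r) _ => sG.
pose I f := forall u, (@poly_rV K n ((u * f) %% P) <= A)%MS.
suff /(_ 1) : I G by rewrite mul1r modp_small // sP.
apply: gcd_ideal => [p q Ip Iq u|u p Ip v|u|l u].
- by rewrite mulrDr modpD linearD; apply: addmx_sub; [apply: Ip | apply: Iq].
- by rewrite mulrA; apply: Ip.
- by rewrite modp_mull linear0 sub0mx.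
- by apply: submx_trans (QA l); apply: poly_rV_modp_sub_cayley_mx.
Qed.

End Gcd.

(* h and d carry the 1-based column indices of the mathematics: t_m is
   col (m - 1) T, so that h m.+1 j.+1 relates the columns of index m and j. *)
Theorem corollary2 (K : fieldType) (charK0 : [pchar K] =i pred0)
  (n r k : nat) (n_gt0 : (0 < n)%N)
  (P : {poly K}) (degP : size P = n.+1)
  (Q : 'I_r -> {poly K}) (degQ : forall l : 'I_r, (size (Q l) <= n.+1)%N)
  (Q_nontriv : ~ (forall l : 'I_r, exists c : K, Q l = c *: P))
  (Phi : n.-tuple {poly_n K}) (Phi_basis : basis_of fullv Phi)
  (le_k_n : (k <= n)%N) (rankB : \rank (stacked_bezmx Phi P Q) = (n - k)%N)
  (T : 'M[K]_(\sum_(l < r) n, n))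
  (defT : T = stacked_bezmx Phi P Q *m (basis_to_St Phi)^T)
  (h : nat -> nat -> K)
  (hT : forall m : 'I_n, (m < k)%N ->
     col m T = \sum_(j < n | (k <= j)%N) h m.+1 j.+1 *: col j T)
  (d : nat -> K) (d0_neq0 : d 0%N != 0)
  (defd : forall i : nat, (i < k)%N -> d i.+1 = d 0%N * h (k - i)%N k.+1) :
  is_gcd P Q (\sum_(i < k.+1) d i *: 'X^(k - i)).
Proof.
have sP : (size P <= n.+1)%N by rewrite degP.
have P0 : P != 0 by rewrite -size_poly_eq0 degP.
set N := basis_to_St Phi in defT.
have uN : N \in unitmx := basis_to_St_unit Phi_basis.
have T_col : T = \mxcol_(l < r) (invmx N *m cayley_mx n P (Q l)).
  rewrite defT mxcol_mul; apply/eq_mxcolP => l.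
  exact: bezmx_mul_basis_to_St.
have rankT : \rank T = (n - k)%N.
  by rewrite defT mxrankMfree // row_free_unit unitmx_tr.
have cayley_sub l : (cayley_mx n P (Q l) <= T)%MS.
  rewrite -[cayley_mx n P (Q l)](mulKVmx uN) mulmx_sub //.
  rewrite (_ : invmx N *m _ = submxcol T l) ?submxcol_sub //.
  by rewrite T_col mxcolK.
have gcdG := is_gcd_big P Q; set G := \big[_/_]_(l < r) _ in gcdG.
have [GP GQ _] := gcdG.
have G0 : G != 0 by apply: contraNneq P0 => G0; move: GP; rewrite G0 dvd0p.
have [g sG] : exists g, size G = g.+1.
  by exists (size G).-1; rewrite prednK // size_poly_gt0.
have le_gn : (g <= n)%N by rewrite -ltnS -sG -degP dvdp_leq.
have le_gk : (g <= k)%N.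
  suff: (n - k <= n - g)%N by rewrite leq_sub2lE.
  rewrite -rankT; apply: leq_trans (rank_leq_row (multiples_mx n g G)).
  apply: mxrankS; apply/row_subP => s; rewrite T_col row_mxcol.
  apply: (submx_trans (row_sub _ _)); apply: mulmx_sub.
  exact: cayley_mx_sub_multiples.
have lt_gn : (g < n)%N.
  rewrite ltn_neqAle le_gn andbT; apply/eqP => eq_gn; apply: Q_nontriv => l.
  have PG : P %= G by rewrite eqp_sym -dvdp_size_eqp // sG eq_gn degP.
  have [->|Ql0] := eqVneq (Q l) 0; first by exists 0; rewrite scale0r.
  have PQ : P %| Q l by rewrite (eqp_dvdl _ PG).
  have : P %= Q l.
    by rewrite -dvdp_size_eqp // eqn_leq (dvdp_leq Ql0 PQ) degP degQ.
  by rewrite eqp_sym => /eqpf_eq[c _ ->]; exists c.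
have G_sub : (@poly_rV K n G <= T)%MS by apply: poly_rV_gcd_sub; rewrite // sG.
have relG (m : nat) : (m < k)%N ->
    G`_m = \sum_(j < n | (k <= j)%N) h m.+1 j.+1 * G`_j.
  move=> lt_mk; have lt_mn := leq_trans lt_mk le_k_n.
  have := row_space_col_relation _ _ _ _ _ _ _ G_sub (hT (Ordinal lt_mn) lt_mk).
  by rewrite mxE => ->; apply: eq_bigr => j _; rewrite mxE.
have eq_gk : g = k.
  apply/eqP; rewrite eqn_leq le_gk leqNgt; apply/negP => lt_gk.
  (* All terms of the relation for the leading coefficient would vanish. *)
  have := relG g lt_gk; rewrite big1 => [|j le_kj]; last first.
    rewrite (nth_default _ (_ : size G <= j)%N) ?mulr0 //.
    by rewrite sG (leq_trans lt_gk).
  by move/eqP; rewrite -[g]/(g.+1.-1) -sG -lead_coefE lead_coef_eq0 (negPf G0).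
subst g.
have relGk (m : nat) : (m < k)%N -> G`_m = h m.+1 k.+1 * G`_k.
  move=> /relG ->; rewrite (bigD1 (Ordinal lt_gn)) //= big1 ?addr0 // => j.
  case/andP => le_kj; rewrite -val_eqE /= => neq_jk.
  rewrite (nth_default _ (_ : size G <= j)%N) ?mulr0 //.
  by rewrite sG ltn_neqAle eq_sym neq_jk.
have Gk0 : G`_k != 0 by rewrite -[k]/(k.+1.-1) -sG -lead_coefE lead_coef_eq0.
apply: is_gcd_eqp gcdG; apply/eqpf_eq; exists (d 0%N / G`_k).
  by rewrite mulf_neq0 ?invr_eq0.
rewrite -[X in _ = _ *: X](coefK G) sG poly_def scaler_sumr.
(* D lists its coefficients by decreasing degree. *)
rewrite [RHS](reindex_inj rev_ord_inj) /=; apply: eq_bigr => i _.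
rewrite subSS scalerA; congr (_ *: _).
case: i => -[|i] /= lt_ik; first by rewrite subn0 divfK.
by rewrite (relGk (k - i.+1)%N) subnSK ?leq_subr // defd // mulrCA divfK // mulrC.
Qed.
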